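(* Let $M$ be a manifold and $\alpha\geqslant 1$ a real number. Let $\Gamma\subset\mathrm{Diff}^\infty(M)$ be a $C^\alpha$-rigid subgroup, and suppose that for some nonempty open set $U\subset M$ (possibly equal to $M$), $\Gamma$ recognizes maps with support in $U$. Then for any map $f\in\mathrm{Homeo}(M)$ with support in $U$, and any real $\beta\geqslant\alpha$, the group $\langle\Gamma,f\rangle$ admits a faithful morphism to $\mathrm{Diff}^\beta(M)$ if and only if $f\in\mathrm{Diff}^\beta(M)$.
   Context: A map $f\colon M\to M$ is of class $C^\alpha$ ($\alpha\geqslant 1$ real) if it is $C^{\lfloor\alpha\rfloor}$ and its $\lfloor\alpha\rfloor$-derivatives are $(\alpha-\lfloor\alpha\rfloor)$-Hölder; $\mathrm{Diff}^\alpha(M)$ is the group of $C^\alpha$ diffeomorphisms of $M$. A subgroup $\Gamma\subset\mathrm{Diff}^\infty(M)$ is $C^\alpha$-rigid if for all real $\beta\geqslant\alpha$, any faithful (injective) group morphism $\Gamma\to\mathrm{Diff}^\beta(M)$ comes from conjugation by some element of $\mathrm{Diff}^\beta(M)$, i.e. is of the form $\gamma\mapsto g\gamma g^{-1}$ with $g\in\mathrm{Diff}^\beta(M)$. For a subset $\mathcal{C}\subset\mathrm{Homeo}(M)$, $\Gamma$ recognizes maps in $\mathcal{C}$ if for every $f\in\mathcal{C}$ and every $h\in\mathrm{Homeo}(M)$, the existence of a group isomorphism $\phi\colon\langle\Gamma,f\rangle\to\langle\Gamma,h\rangle$ with $\phi|_\Gamma=\mathrm{id}_\Gamma$ and $\phi(f)=h$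 implies $h=f$. The support of $f$ is the closure of $\{x\mid f(x)\neq x\}$, and $\langle\Gamma,f\rangle$ is the subgroup of $\mathrm{Homeo}(M)$ generated by $\Gamma$ and $f$. *)

(* Defs.v *)
From HB Require Import structures.
From mathcomp Require Import all_boot all_order all_algebra.
From mathcomp Require Import all_classical all_reals all_analysis.

Set Implicit Arguments.
Unset Strict Implicit.
Unset Printing Implicit Defensive.

Import Order.TTheory GRing.Theory Num.Theory.
Import numFieldNormedType.Exports.

Local Open Scope classical_set_scope.
Local Open Scope ring_scope.

Record homeo (M : topologicalType) := Homeo {
  homeo_fun :> M -> M;
  homeo_inv : M -> M;
  homeo_continuous : continuous homeo_fun;
  homeo_inv_continuous : continuous homeo_inv;
  homeoK : cancel homeo_fun homeo_inv;
  homeoKV : cancel homeo_inv homeo_fun }.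

Lemma homeo_eqP (M : topologicalType) (f g : homeo M) : f =1 g -> f = g.
Proof.
case: f g => [f f' fc fc' fK fKV] [g g' gc gc' gK gKV] /= /funext efg.
subst g.
have /funext e : f' =1 g' by move=> x; rewrite -{1}(gKV x) fK.
by subst g'; congr Homeo; exact: Prop_irrelevance.
Qed.

Section HomeoGroup.
Variable M : topologicalType.

Definition homeo_one : homeo M :=
  @Homeo M id id (fun=> cvg_id) (fun=> cvg_id) (fun=> erefl) (fun=> erefl).

Definition homeo_mul (f g : homeo M) : homeo M :=
  Homeo (fun x => continuous_comp (@homeo_continuous _ g x)
                                  (@homeo_continuous _ f (g x)))
        (fun x => continuous_comp (@homeo_inv_continuous _ f x)
                                  (@homeo_inv_continuous _ g (homeo_inv f x)))
        (can_comp (@homeoK _ f) (@homeoK _ g))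
        (can_comp (@homeoKV _ g) (@homeoKV _ f)).

Definition homeo_invg (f : homeo M) : homeo M :=
  Homeo (@homeo_inv_continuous _ f) (@homeo_continuous _ f)
        (@homeoKV _ f) (@homeoK _ f).

Lemma homeo_mulA : associative homeo_mul.
Proof. by move=> f g h; exact: homeo_eqP. Qed.

Lemma homeo_mul1 : left_id homeo_one homeo_mul.
Proof. by move=> f; exact: homeo_eqP. Qed.

Lemma homeo_mulr1 : right_id homeo_one homeo_mul.
Proof. by move=> f; exact: homeo_eqP. Qed.

Lemma homeo_mulV : left_inverse homeo_one homeo_invg homeo_mul.
Proof. by move=> f; apply: homeo_eqP => x; exact: homeoK. Qed.

Lemma homeo_mulrV : right_inverse homeo_one homeo_invg homeo_mul.
Proof. by move=> f; apply: homeo_eqP => x; exact: homeoKV. Qed.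

HB.instance Definition _ := gen_eqMixin (homeo M).
HB.instance Definition _ := gen_choiceMixin (homeo M).
HB.instance Definition _ := isGroup.Build (homeo M)
  homeo_mulA homeo_mul1 homeo_mulr1 homeo_mulV homeo_mulrV.

End HomeoGroup.

Definition homeo_support (M : topologicalType) (f : homeo M) : set M :=
  closure [set x | f x <> x].

Section Subgroups.
Variables X Y : groupType.

Definition subgroup (G : set X) : Prop := group_closed [in G].

Definition generated (A : set X) : set X := smallest subgroup A.

(* Morphisms out of a subgroup G are represented by total functions on X, of
   which only the values on G matter. *)
Definition faithful_morphism (G : set X) (H : set Y) (phi : X -> Y) : Prop :=
  [/\ set_fun G H phi,
      {in G &, {morph phi : x y / (x * y)%g}} &
      set_inj G phi].

Definition group_isomorphism (G : set X) (H : set Y) (phi : X -> Y) : Prop :=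
  set_bij G H phi /\ {in G &, {morph phi : x y / (x * y)%g}}.

End Subgroups.

Section Regularity.
Variables (R : realType) (n : nat) (V : normedModType R).
Implicit Types (U : set 'rV[R]_n) (f : 'rV[R]_n -> V).

Definition iter_partial (s : seq 'I_n) f : 'rV[R]_n -> V :=
  foldr (fun i g x => 'D_(delta_mx 0 i) g x) f s.

(* Only meant for open U, on which the germs of f determine its derivatives. *)
Definition Ck_on (k : nat) U f : Prop :=
  (forall s, (size s < k)%N -> forall x, U x ->
     differentiable (iter_partial s f) x) /\
  (forall s, (size s <= k)%N -> forall x, U x ->
     {for x, continuous (iter_partial s f)}).

Definition smooth_on U f : Prop := forall k, Ck_on k U f.

(* The Hoelder condition is local: this is the chart-independent notion, and
   on a compact manifold it coincides with the global one. For theta = 0 it is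
   local boundedness, hence adds nothing to continuity. *)
Definition locally_holder_on (theta : R) U f : Prop :=
  forall x, U x -> exists C : R,
    \forall y & z \near x, `|f y - f z| <= C * `|y - z| `^ theta.

Definition Calpha_on (alpha : R) U f : Prop :=
  Ck_on (Num.truncn alpha) U f /\
  forall s, size s = Num.truncn alpha ->
    locally_holder_on (alpha - (Num.truncn alpha)%:R) U (iter_partial s f).

End Regularity.

Record chart (R : realType) (n : nat) (M : topologicalType) := Chart {
  chart_dom : set M;
  chart_fun :> M -> 'rV[R]_n;
  chart_inv : 'rV[R]_n -> M;
  chart_dom_open : open chart_dom;
  chart_codom_open : open (chart_fun @` chart_dom);
  chart_continuous : {within chart_dom, continuous chart_fun};
  chart_inv_continuous :
    {within chart_fun @` chart_dom, continuous chart_inv};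
  chartK : {in chart_dom, cancel chart_fun chart_inv} }.

(* The atlas need not be maximal: regularity of maps as defined below is the
   same for an atlas and for the maximal atlas containing it. *)
Record smoothManifold (R : realType) (n : nat) := SmoothManifold {
  manifold_carrier :> topologicalType;
  atlas : set (chart R n manifold_carrier);
  manifold_hausdorff : hausdorff_space manifold_carrier;
  manifold_second_countable : @second_countable manifold_carrier;
  atlas_cover : \bigcup_(c in atlas) chart_dom c = [set: manifold_carrier];
  atlas_compatible : forall c d, atlas c -> atlas d ->
    smooth_on (c @` (chart_dom c `&` chart_dom d)) (d \o chart_inv c) }.

Section Diffeomorphisms.
Variables (R : realType) (n : nat) (M : smoothManifold R n).

(* P U g : the map g, read in charts, has the wanted regularity on U *)
Definition regular_map (P : set 'rV[R]_n -> ('rV[R]_n -> 'rV[R]_n) -> Prop)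
    (f : M -> M) : Prop :=
  forall c d, atlas c -> atlas d ->
    P (c @` (chart_dom c `&` f @^-1` chart_dom d)) (d \o f \o chart_inv c).

Definition Diff (alpha : R) : set (homeo M) :=
  [set f : homeo M | regular_map (Calpha_on alpha) f /\
           regular_map (Calpha_on alpha) (f^-1 : homeo M)%g].

Definition Diff_infty : set (homeo M) :=
  [set f : homeo M | regular_map (@smooth_on R n _) f /\
           regular_map (@smooth_on R n _) (f^-1 : homeo M)%g].

Definition rigid (alpha : R) (Gamma : set (homeo M)) : Prop :=
  forall (beta : R), alpha <= beta ->
  forall phi : homeo M -> homeo M,
    faithful_morphism Gamma (Diff beta) phi ->
    exists2 g, Diff beta g &
      {in Gamma, phi =1 fun gamma => (g * gamma * g^-1)%g}.

End Diffeomorphisms.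

Arguments Diff {R n} M alpha _.
Arguments Diff_infty {R n} M _.

Definition recognizes (M : topologicalType) (Gamma C : set (homeo M)) : Prop :=
  forall f h : homeo M, C f ->
    (exists phi : homeo M -> homeo M,
       [/\ group_isomorphism (generated (Gamma `|` [set f]))
                             (generated (Gamma `|` [set h])) phi,
           {in Gamma, phi =1 id} &
           phi f = h]) ->
    h = f.

(* Main.v *)
Require Import Defs.
From mathcomp Require Import all_boot all_order all_algebra.
From mathcomp Require Import all_classical all_reals all_analysis.
From mathcomp Require Import ring lra.

(** Everything rests on the fact that [Diff M beta] is a group containing
[Diff_infty M].

Granted this, if [f] is in [Diff M beta] then so is the whole group generated
by [Gamma] and [f], and the identity is the required embedding. Conversely,
let [phi] embed the group generated by [Gamma] and [f] into [Diff M beta]. Its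
restriction to [Gamma] is the conjugation by some [g] in [Diff M beta], by
rigidity. So [psi x = g^-1 * phi x * g] fixes [Gamma] pointwise, and it is an
isomorphism onto the group generated by [Gamma] and [h = psi f]
([image_generated]). As [Gamma] recognizes [f], the map [h] is [f]; but [h] is a
product of elements of [Diff M beta].

The analysis lies in the group property ([subgroup_Diff]), i.e. in the
stability of the C^(k, theta) maps of R^n under composition, for k >= 1 and
theta in [0, 1]. It is proved by induction on k from the recursive description
[Cholder] of this class: f is C^(k+1, theta) when it is differentiable and its
partial derivatives are C^(k, theta). By the chain rule the partial derivatives
of f o g are sums of products of the partial derivatives of the components of g
with those of f composed with g. So one needs stability under sums
([CholderD]) and products ([CholderM]), and the inclusion of C^(k+1, theta') in
C^(k, theta) ([Cholder_weaken]). This inclusion, like the step k = 0 of the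
composition ([holder_comp]), comes down to the fact that a C^1 map is locally
Lipschitz, a consequence of the mean value theorem on segments
([C1_locally_lipschitz]). The inclusion also shows that smooth maps are
C^(k, theta).
Vector-valued maps are handled coordinate by coordinate ([Cholder_row]). *)

Set Implicit Arguments.
Unset Strict Implicit.
Unset Printing Implicit Defensive.

Import Order.TTheory GRing.Theory Num.Theory.
Import numFieldNormedType.Exports.

Local Open Scope classical_set_scope.
Local Open Scope ring_scope.

(** * Germs and local Hoelder conditions *)

Section Germs.
Variables (R : realType) (V W : normedModType R).

(** The difference [g - f] vanishes near [a], hence has differential 0 at [a]. *)
Lemma near_eq_differentiable (f g : V -> W) (a : V) :
  (\forall x \near a, f x = g x) -> differentiable f a -> differentiable g a.
Proof.
move=> fg df; rewrite (_ : g = f + (g - f)); last by rewrite addrC subrK.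
apply: differentiableD => //.
have fga : g a - f a = 0 by rewrite (nbhs_singleton fg) subrr.
have dz : (g - f) \o shift a = cst ((g - f) a) + \0 +o_ 0 id.
  apply/eqaddoP => e e0 /=; near=> h.
  rewrite -[X in `|X|]/((g (h + a) - f (h + a)) - ((g a - f a) + 0)).
  rewrite addr0 fga subr0 (_ : f (h + a) = g (h + a)).
    by rewrite subrr normr0 mulr_ge0// ltW.
  near: h.
  by have := fg; rewrite (near_shift 0)/=; apply: filterS => h /=; rewrite subr0.
have c0 : continuous (\0 : {linear V -> W}) by move=> x; exact: cvg_cst.
have d0 := diff_unique c0 dz.
by apply/diff_locallyP; rewrite d0.
Unshelve. all: by end_near. Qed.

End Germs.

Section Holder.
Variables (R : realType) (n : nat) (V : normedModType R).
Implicit Types (U : set 'rV[R]_n) (f : 'rV[R]_n -> V) (theta : R).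

(** With one neighbourhood common to both points and a nonnegative constant,
Hoelder estimates combine by intersecting the neighbourhoods and adding or
multiplying the constants. *)
Lemma locally_holderP theta U f : locally_holder_on theta U f <->
  forall x, U x -> exists (C : R) A,
    [/\ 0 <= C, nbhs x A & forall y z, A y -> A z ->
    `|f y - f z| <= C * `|y - z| `^ theta].
Proof.
split=> H x Ux.
- have [C [[A B] /= [xA xB] AB]] := H x Ux.
  exists `|C|, (A `&` B); split => //; first exact: filterI.
  move=> y z [Ay _] [_ Bz].
  apply: le_trans (AB (y, z) (conj Ay Bz)) _ => /=.
  by apply: ler_wpM2r; [exact: powR_ge0|exact: ler_norm].
- have [C [A [_ xA H']]] := H x Ux.
  by exists C; exists (A, A) => //= -[y z] /= [Ay Az]; exact: H'.
Qed.

(** On a ball of radius 1/2 distances are at most 1, where a smaller exponent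
gives a larger power. *)
Lemma holder_le theta theta' U f : theta <= theta' ->
  locally_holder_on theta' U f -> locally_holder_on theta U f.
Proof.
move=> tt' /locally_holderP H; apply/locally_holderP => x Ux.
have [C [A [C0 xA CA]]] := H x Ux.
exists C, (A `&` ball x (1 / 2)); split => //.
  by apply: filterI => //; apply: nbhsx_ballx; lra.
move=> y z [Ay xy] [Az xz].
have [->|yz] := eqVneq y z; first by rewrite subrr normr0 mulr_ge0// powR_ge0.
apply: le_trans (CA _ _ Ay Az) _; apply: ler_wpM2l => //.
have yz1 : `|y - z| <= 1.
  move: xy xz; rewrite -!ball_normE /= => xy xz.
  have := ler_distD x y z; rewrite (distrC y x); lra.
by apply: ger_powR => //; rewrite normr_gt0 subr_eq0 yz.
Qed.

Lemma holder0 U f : (forall x, U x -> {for x, continuous f}) ->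
  locally_holder_on 0 U f.
Proof.
move=> cf; apply/locally_holderP => x /cf /cvgrPdist_lt /(_ 1 ltr01) xA.
exists 2, [set y | `|f x - f y| < 1]; split => // y z /= Ay Az.
rewrite powRr0 mulr1.
have := ler_distD (f x) (f y) (f z); rewrite (distrC (f y) (f x)); lra.
Qed.

Lemma holderD theta U f g : locally_holder_on theta U f ->
  locally_holder_on theta U g -> locally_holder_on theta U (f \+ g).
Proof.
move=> /locally_holderP F /locally_holderP G; apply/locally_holderP => x Ux.
have [C [A [C0 xA CA]]] := F x Ux; have [D [B [D0 xB DB]]] := G x Ux.
exists (C + D), (A `&` B); split; [exact: addr_ge0|exact: filterI|].
move=> y z [Ay By] [Az Bz] /=.
rewrite opprD addrACA mulrDl (le_trans (ler_normD _ _))// lerD//.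
  exact: CA.
exact: DB.
Qed.

End Holder.

Section HolderScalar.
Variables (R : realType) (n : nat).
Implicit Types (U : set 'rV[R]_n) (f g : 'rV[R]_n -> R) (theta : R).

(** f y g y - f z g z = (f y - f z) g y + f z (g y - g z), where [f] and [g] are
locally bounded by continuity. *)
Lemma holderM theta U f g :
  (forall x, U x -> {for x, continuous f}) ->
  (forall x, U x -> {for x, continuous g}) ->
  locally_holder_on theta U f ->
  locally_holder_on theta U g -> locally_holder_on theta U (f \* g).
Proof.
move=> cf cg /locally_holderP F /locally_holderP G; apply/locally_holderP => x Ux.
have [C [A [C0 xA CA]]] := F x Ux; have [D [B [D0 xB DB]]] := G x Ux.
have bounded (h : 'rV[R]_n -> R) : {for x, continuous h} ->
    \forall y \near x, `|h y| <= `|h x| + 1.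
  move=> /cvgrPdist_lt /(_ 1 ltr01); apply: filterS => y /= hxy.
  by have := ler_distD (h x) (h y) 0; rewrite !subr0 distrC; lra.
exists (C * (`|g x| + 1) + (`|f x| + 1) * D),
  ((A `&` [set y | `|f y| <= `|f x| + 1]) `&`
   (B `&` [set y | `|g y| <= `|g x| + 1])); split.
- by rewrite addr_ge0// mulr_ge0// addr_ge0.
- by apply: filterI; apply: filterI => //; apply: bounded; [exact: cf|exact: cg].
move=> y z [[Ay fy] [By gy]] [[Az fz] [Bz gz]] /=.
rewrite (_ : _ - _ = (f y - f z) * g y + f z * (g y - g z)); last by ring.
apply: le_trans (ler_normD _ _) _; rewrite [leRHS]mulrDl !normrM lerD//.
  by rewrite mulrAC; apply: ler_pM => //; exact: CA.
by rewrite -mulrA; apply: ler_pM => //; exact: DB.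
Qed.

End HolderScalar.

Lemma holder_comp (R : realType) (m n : nat) (V : normedModType R) (theta : R)
    (U : set 'rV[R]_m) (W : set 'rV[R]_n)
    (g : 'rV[R]_m -> 'rV[R]_n) (f : 'rV[R]_n -> V) :
  0 <= theta -> g @` U `<=` W -> (forall x, U x -> {for x, continuous g}) ->
  locally_holder_on 1 U g -> locally_holder_on theta W f ->
  locally_holder_on theta U (f \o g).
Proof.
move=> t0 gUW cg /locally_holderP G /locally_holderP F.
apply/locally_holderP => x Ux.
have [C [A [C0 xA CA]]] := G x Ux.
have [D [B [D0 xB DB]]] := F (g x) (gUW _ (imageP _ Ux)).
exists (D * C `^ theta), (A `&` g @^-1` B); split.
- by rewrite mulr_ge0// powR_ge0.
- by apply: filterI => //; exact: (cg _ Ux).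
move=> y z [Ay By] [Az Bz] /=.
apply: le_trans (DB _ _ By Bz) _; rewrite -mulrA; apply: ler_wpM2l => //.
rewrite -powRM//; apply: ge0_ler_powR; rewrite ?nnegrE ?mulr_ge0//.
by have := CA _ _ Ay Az; rewrite powRr1.
Qed.

(** * Row vectors and their coordinates *)

Section RowVectors.
Variables (R : realType) (n : nat).

Lemma ler_norm_coord (v : 'rV[R]_n) i : `|v 0 i| <= `|v|.
Proof.
rewrite [leRHS]/Num.Def.normr/= mx_normrE.
exact: (le_bigmax _ (fun ij => `|v ij.1 ij.2|) (0, i)).
Qed.

Lemma norm_row_le (v : 'rV[R]_n) (e : R) : 0 <= e ->
  (forall i, `|v 0 i| <= e) -> `|v| <= e.
Proof.
move=> e0 ve; rewrite [leLHS]/Num.Def.normr/= mx_normrE.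
by apply: bigmax_le => // -[i j] _ /=; rewrite ord1.
Qed.

Lemma continuous_row (T : topologicalType) (f : T -> 'rV[R]_n) x :
  (forall i, {for x, continuous (fun y => f y 0 i)}) -> {for x, continuous f}.
Proof.
move=> cf; apply/cvgrPdist_le => /= e e0.
have : \forall y \near x, forall i, `|f x 0 i - f y 0 i| <= e.
  by apply: filter_forall => i; move/cvgrPdist_le: (cf i); apply.
apply: filterS => y fe; apply: norm_row_le; first exact: ltW.
by move=> i; rewrite !mxE.
Qed.

Lemma differentiable_row (V : normedModType R) (f : V -> 'rV[R]_n) x :
  (forall i, differentiable (fun y => f y 0 i) x) -> differentiable f x.
Proof.
move=> df; rewrite (_ : f =
    \sum_(i < n) (fun y => f y 0 i *: delta_mx 0 i : 'rV[R]_n)); last first.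
  by apply/funext => y; rewrite fct_sumE [LHS]row_sum_delta.
by apply: differentiable_sum => i; exact: differentiableZl.
Qed.

(** For the norm of the maximum, the sum of the constants of the coordinates
serves for the vector. *)
Lemma locally_holder_row theta m (U : set 'rV[R]_m) (f : 'rV[R]_m -> 'rV[R]_n) :
  (forall i, locally_holder_on theta U (fun y => f y 0 i)) <->
  locally_holder_on theta U f.
Proof.
split=> [H|/locally_holderP H i]; last first.
  apply/locally_holderP => x /H[C [A [C0 xA CA]]]; exists C, A; split => //.
  move=> y z Ay Az; apply: le_trans (CA _ _ Ay Az).
  by have := ler_norm_coord (f y - f z) i; rewrite !mxE.
apply/locally_holderP => x Ux.
have /choice[CA P] : forall i, exists CA : R * set 'rV[R]_m,
    [/\ 0 <= CA.1, nbhs x CA.2 & forall y z, CA.2 y -> CA.2 z ->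
      `|f y 0 i - f z 0 i| <= CA.1 * `|y - z| `^ theta].
  move=> i; have /locally_holderP/(_ x Ux)[C [A ?]] := H i.
  by exists (C, A).
exists (\sum_i (CA i).1), [set y | forall i, (CA i).2 y]; split.
- by apply: sumr_ge0 => i _; have [] := P i.
- have xCA i : \forall y \near x, (CA i).2 y by have [] := P i.
  exact: filter_forall xCA.
move=> y z Ay Az; apply: norm_row_le.
  by rewrite mulr_ge0 ?powR_ge0// sumr_ge0// => i _; have [] := P i.
move=> i; rewrite !mxE; have [_ _ /(_ y z (Ay i) (Az i)) le1] := P i.
apply: le_trans le1 _; rewrite ler_wpM2r ?powR_ge0//.
by rewrite (bigD1 i)//= lerDl sumr_ge0// => j _; have [] := P j.
Qed.

End RowVectors.

(** * C^1 functions are locally Lipschitz *)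

Section PartialDerivatives.
Variables (R : realType) (n : nat).

Lemma diff_partial (V : normedModType R) (f : 'rV[R]_n -> V) (x v : 'rV[R]_n) :
  differentiable f x ->
  'd f x v = \sum_(i < n) v 0 i *: 'D_(delta_mx 0 i) f x.
Proof.
move=> df; rewrite {1}(row_sum_delta v) linear_sum; apply: eq_bigr => i _ /=.
by rewrite linearZ /= deriveE.
Qed.

Lemma ball_segment (x y z : 'rV[R]_n) (r t : R) : 0 <= t <= 1 ->
  ball x r y -> ball x r z -> ball x r (z + t *: (y - z)).
Proof.
move=> /andP[t0 t1]; rewrite -!ball_normE /= => xy xz.
have -> : x - (z + t *: (y - z)) = (1 - t) *: (x - z) + t *: (x - y).
  by apply/rowP => i; rewrite !mxE; ring.
apply: le_lt_trans (ler_normD _ _) _; rewrite !normrZ.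
rewrite (ger0_norm t0) (ger0_norm (_ : 0 <= 1 - t)) ?subr_ge0//.
have [m [mr ym zm]] : exists m, [/\ m < r, `|x - y| <= m & `|x - z| <= m].
  exists (Num.max `|x - y| `|x - z|).
  by rewrite gt_max xy xz !le_max !lexx orbT.
by apply: le_lt_trans mr; nra.
Qed.

(** Reduces the mean value theorem between two points of R^n to the one on the
unit interval of the real line. *)
Lemma is_derive_segment (f : 'rV[R]_n -> R) (z v : 'rV[R]_n) (t : R) :
  differentiable f (z + t *: v) ->
  is_derive t 1 (fun s : R => f (z + s *: v)) ('d f (z + t *: v) v).
Proof.
move=> df; pose g := cst z + ( *:%R^~ v) : R -> 'rV[R]_n.
have dg : is_diff t g (0 + ( *:%R^~ v)) by exact: is_diffD.
have dfg : differentiable (f \o g) t by apply: differentiable_comp.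
apply: DeriveDef; first exact: diff_derivable.
rewrite -[X in 'D_1 X t]/(f \o g) deriveE// diff_comp//= diff_val.
by rewrite /= -[(0 + _) 1]/(0 + 1 *: v) add0r scale1r.
Qed.

(** On a ball around [x] where each partial derivative differs from its value at
[x] by less than 1, the sum of the |D_i f x| + 1 is a Lipschitz constant: the
ball is convex, so the mean value theorem applies on segments. *)
Lemma C1_locally_lipschitz (U : set 'rV[R]_n) (f : 'rV[R]_n -> R) :
  open U -> (forall x, U x -> differentiable f x) ->
  (forall i x, U x -> {for x, continuous ('D_(delta_mx 0 i) f)}) ->
  locally_holder_on 1 U f.
Proof.
move=> oU df cDf; apply/locally_holderP => x Ux.
have : \forall y \near x,
    U y /\ forall i, `|'D_(delta_mx 0 i) f x - 'D_(delta_mx 0 i) f y| < 1.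
  apply: filterI; first exact: open_nbhs_nbhs.
  have near1 i : \forall y \near x,
      `|'D_(delta_mx 0 i) f x - 'D_(delta_mx 0 i) f y| < 1.
    by have /cvgrPdist_lt/(_ 1 ltr01) := cDf i x Ux.
  exact: filter_forall near1.
move=> /nbhs_ballP[r /= r0 xr].
exists (\sum_(i < n) (`|'D_(delta_mx 0 i) f x| + 1)), (ball x r); split.
- by apply: sumr_ge0 => i _; rewrite addr_ge0.
- exact: nbhsx_ballx.
move=> y z xy xz; rewrite powRr1//.
pose p (t : R) := z + t *: (y - z).
have xp (t : R) : 0 <= t <= 1 -> ball x r (p t) by move=> t01; exact: ball_segment.
have dp (t : R) : 0 <= t <= 1 -> is_derive t 1 (f \o p) ('d f (p t) (y - z)).
  by move=> /xp/xr[Upt _]; exact/is_derive_segment/df.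
have [|||c c01 fyz] := @MVT_segment R (f \o p) (fun t => 'd f (p t) (y - z)) 0 1.
- exact: ler01.
- by move=> t /[!in_itv]/= /andP[t0 t1]; apply: dp; rewrite !ltW.
- apply: derivable_within_continuous => t /[!in_itv]/= /dp.
  by case.
have {}fyz : f y - f z = 'd f (p c) (y - z).
  move: fyz; rewrite /= subr0 mulr1 /p scale1r scale0r addr0.
  by rewrite (addrC z) subrK.
have /xr[Upc Dpc] : ball x r (p c) by apply: xp; rewrite in_itv in c01.
rewrite fyz diff_partial; last exact: df.
rewrite mulr_suml; apply: le_trans (ler_norm_sum _ _ _) _.
apply: ler_sum => i _; rewrite normrM mulrC; apply: ler_pM => //.
  have := ler_distD ('D_(delta_mx 0 i) f x) ('D_(delta_mx 0 i) f (p c)) 0.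
  rewrite !subr0 distrC; have := Dpc i; lra.
exact: ler_norm_coord.
Qed.

End PartialDerivatives.

(** * The classes C^(k, theta) *)

Section HolderClasses.
Variables (R : realType) (n : nat).

(** The C^(k, theta) maps, described by recursion on k so that a statement about
f at order k + 1 reduces to one about its partial derivatives at order k. The
family of all iterated partial derivatives satisfies the conditions of
[Calpha_on] exactly when this holds ([CholderP]). *)
Fixpoint Cholder (V : normedModType R) (theta : R) k (U : set 'rV[R]_n)
    (f : 'rV[R]_n -> V) : Prop :=
  if k is k'.+1 then
    (forall x, U x -> differentiable f x) /\
    (forall i, Cholder theta k' U ('D_(delta_mx 0 i) f))
  else (forall x, U x -> {for x, continuous f}) /\ locally_holder_on theta U f.

Section AnyTarget.
Variables (V : normedModType R).
Implicit Types (U : set 'rV[R]_n) (f : 'rV[R]_n -> V) (theta : R).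

Lemma iter_partial_rcons s i f :
  iter_partial (rcons s i) f = iter_partial s ('D_(delta_mx 0 i) f).
Proof. by rewrite /iter_partial foldr_rcons. Qed.

Lemma Cholder_continuous theta k U f : Cholder theta k U f ->
  forall x, U x -> {for x, continuous f}.
Proof.
case: k => [|k] [] // df _ x Ux.
exact/differentiable_continuous/df.
Qed.

(** [iter_partial (rcons s i) f] differentiates along [i] first, so that peeling
off the last element of a sequence of directions matches the recursion. *)
Lemma CholderP theta k U f :
  Ck_on k U f /\
    (forall s, size s = k -> locally_holder_on theta U (iter_partial s f)) <->
  Cholder theta k U f.
Proof.
elim: k f => [|k IH] f.
  split=> [[[_ cf] hf]|[cf hf]].
    by split; [exact: (cf [::])|exact: (hf [::])].
  by split; [split|] => // -[].
split=> [[[df cf] hf]|[df Df]].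
  split=> [|i]; first exact: (df [::]).
  apply/IH; split; [split|] => s sk; rewrite -iter_partial_rcons.
  - by apply: df; rewrite size_rcons.
  - by apply: cf; rewrite size_rcons.
  - by apply: hf; rewrite size_rcons sk.
have H i := (IH _).2 (Df i).
split; [split|] => s; case/lastP: s => [|s i]//.
- by rewrite size_rcons iter_partial_rcons; apply: (H i).1.1.
- by move=> _ x Ux; exact/differentiable_continuous/df.
- by rewrite size_rcons iter_partial_rcons; apply: (H i).1.2.
- by rewrite size_rcons iter_partial_rcons => -[]; apply: (H i).2.
Qed.

Lemma Calpha_onP alpha U f : Calpha_on alpha U f <->
  Cholder (alpha - (Num.truncn alpha)%:R) (Num.truncn alpha) U f.
Proof. exact: CholderP. Qed.

Lemma Ck_Cholder0 k U f : Ck_on k U f -> Cholder 0 k U f.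
Proof.
move=> Ckf; apply/CholderP; split=> // s sk; apply: holder0.
by apply: Ckf.2; rewrite sk.
Qed.

(** All the conditions are pointwise on [U], the Hoelder one because it only
involves germs. *)
Lemma Cholder_local theta k U f :
  (forall x, U x -> exists2 W, W x & Cholder theta k W f) ->
  Cholder theta k U f.
Proof.
elim: k f => [|k IH] f H.
  split=> x Ux; have [W Wx [cf hf]] := H x Ux; [exact: cf|exact: hf].
split=> [x Ux|i]; first by have [W Wx [df _]] := H x Ux; exact: df.
by apply: IH => x Ux; have [W Wx [_ Df]] := H x Ux; exists W => //; exact: Df.
Qed.

Lemma Cholder_sub theta k U W f : W `<=` U ->
  Cholder theta k U f -> Cholder theta k W f.
Proof. by move=> WU Cf; apply: Cholder_local => x /WU Ux; exists U. Qed.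

(** On an open set, maps that agree have the same germs, hence the same partial
derivatives. This is what allows computing derivatives only on [U]. *)
Lemma Cholder_eq theta k U f g : open U -> (forall x, U x -> f x = g x) ->
  Cholder theta k U f -> Cholder theta k U g.
Proof.
move=> oU; have near_eq (a b : 'rV[R]_n -> V) x :
    (forall x, U x -> a x = b x) -> U x -> \forall y \near x, a y = b y.
  move=> ab Ux; have : nbhs x U by exact: open_nbhs_nbhs.
  exact: filterS.
elim: k f g => [|k IH] f g fg.
  move=> [cf hf]; split=> [x Ux|].
    suff : g @ x --> f x by rewrite fg.
    have /near_eq_cvg gf : {near x, f =1 g} := near_eq f g x fg Ux.
    exact: cvg_trans gf (cf x Ux).
  apply/locally_holderP => x Ux.
  have [C [A [C0 xA CA]]] := (locally_holderP _ _ _).1 hf x Ux.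
  exists C, (A `&` U); split => //.
    by apply: filterI => //; exact: open_nbhs_nbhs.
  by move=> y z [Ay Uy] [Az Uz]; rewrite -!fg//; exact: CA.
move=> [df Df]; split=> [x Ux|i].
  by apply: near_eq_differentiable (df x Ux); exact: near_eq.
apply: IH (Df i) => x Ux; apply: near_eq_derive; exact: near_eq.
Qed.

Lemma Cholder_cst theta k U (a : V) : Cholder theta k U (cst a).
Proof.
elim: k a => [|k IH] a.
  split=> [x _|]; first exact: cst_continuous.
  apply/locally_holderP => x _; exists 0, setT; split => //.
    exact: filterT.
  by move=> y z _ _; rewrite subrr normr0 mul0r.
split=> [x _|i]; first exact: differentiable_cst.
rewrite (_ : 'D_(delta_mx 0 i) (cst a) = cst 0)//.
by apply/funext => x; rewrite derive_cst.
Qed.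

Lemma CholderD theta k U f g : open U ->
  Cholder theta k U f -> Cholder theta k U g -> Cholder theta k U (f + g).
Proof.
move=> oU; elim: k f g => [|k IH] f g [df Df] [dg Dg].
  split; last exact: holderD.
  by move=> x Ux; apply: continuousD; [exact: df|exact: dg].
split=> [x Ux|i]; first by apply: differentiableD; [exact: df|exact: dg].
apply: Cholder_eq (IH _ _ (Df i) (Dg i)) => // x Ux.
by rewrite deriveD//; apply: diff_derivable; [exact: df|exact: dg].
Qed.

Lemma Cholder_sum theta k U (I : Type) (r : seq I) (F : I -> 'rV[R]_n -> V) :
  open U -> (forall i, Cholder theta k U (F i)) ->
  Cholder theta k U (\sum_(i <- r) F i).
Proof.
move=> oU CF; elim/big_ind : _ => // [|f g Cf Cg].
  exact: (Cholder_cst _ _ _ 0).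
exact: CholderD.
Qed.

End AnyTarget.

(** Differentiation commutes with coordinates. This reduces the study of
vector-valued maps to real-valued ones, for which products and the mean value
theorem make sense. *)
Lemma Cholder_row m theta k (U : set 'rV[R]_n) (f : 'rV[R]_n -> 'rV[R]_m) :
  open U ->
  (forall j, Cholder theta k U (fun x => f x 0 j)) <-> Cholder theta k U f.
Proof.
move=> oU; elim: k f => [|k IH] f.
  split=> [H|[cf hf] j].
    split=> [x Ux|]; last first.
      by apply: (locally_holder_row _ _ _).1 => j; have [] := H j.
    by apply: continuous_row => j; have [cf _] := H j; exact: cf.
  split; last exact: (locally_holder_row _ _ _).2.
  move=> x Ux.
  apply: (@continuous_comp _ _ _ f (fun M : 'rV[R]_m => M 0 j)).
    exact: cf.
  exact: coord_continuous.
have dcoord x i j : differentiable f x ->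
    ('D_(delta_mx 0 i) f x) 0 j = 'D_(delta_mx 0 i) (fun y => f y 0 j) x.
  by move=> df; rewrite derive_mx ?mxE//; exact: diff_derivable.
split=> [H|[df Df] j].
  have df x : U x -> differentiable f x.
    by move=> Ux; apply: differentiable_row => j; have [dfj _] := H j; exact: dfj.
  split=> // i; apply/IH => j; have [_ /(_ i)] := H j.
  by apply: Cholder_eq => // x /df /dcoord ->.
split=> [x Ux|i].
  apply: (@differentiable_comp _ _ _ _ f (fun M : 'rV[R]_m => M 0 j)).
    exact: df.
  exact: differentiable_coord.
have /IH/(_ j) := Df i.
by apply: Cholder_eq => // x /df /dcoord ->.
Qed.

Lemma Cholder_lipschitz m theta k (U : set 'rV[R]_n)
    (f : 'rV[R]_n -> 'rV[R]_m) : open U ->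
  Cholder theta k.+1 U f -> locally_holder_on 1 U f.
Proof.
move=> oU /(Cholder_row _ _ _ oU) Cf; apply/locally_holder_row => j.
have [df Df] := Cf j; apply: C1_locally_lipschitz => // i.
exact: Cholder_continuous (Df i).
Qed.

Section ScalarTarget.
Implicit Types (U : set 'rV[R]_n) (f g : 'rV[R]_n -> R) (theta : R).

(** A C^1 function is locally Lipschitz, hence locally Hoelder for every exponent
at most 1: this is order 0, to which the higher orders reduce by passing to
partial derivatives. *)
Lemma Cholder_weaken_scalar theta theta' k U f : theta <= 1 ->
  open U -> Cholder theta' k.+1 U f -> Cholder theta k U f.
Proof.
move=> t1 oU; elim: k f => [|k IH] f [df Df].
  split=> [x Ux|]; first exact/differentiable_continuous/df.
  apply: holder_le t1 _; apply: C1_locally_lipschitz => // i.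
  by have [] := Df i.
by split=> // i; exact: IH.
Qed.

(** In the Leibniz rule f and g appear undifferentiated: they are of order k + 1
and have to be seen as of order k. *)
Lemma CholderM theta k U f g : theta <= 1 -> open U ->
  Cholder theta k U f -> Cholder theta k U g -> Cholder theta k U (f * g).
Proof.
move=> t1 oU; elim: k f g => [|k IH] f g Cf Cg.
  split=> [x Ux|]; first by apply: continuousM; [exact: Cf.1|exact: Cg.1].
  by case: Cf Cg => cf hf [cg hg]; exact: holderM.
have [df Df] := Cf; have [dg Dg] := Cg.
split=> [x Ux|i]; first by apply: differentiableM; [exact: df|exact: dg].
have wf := Cholder_weaken_scalar t1 oU Cf.
have wg := Cholder_weaken_scalar t1 oU Cg.
apply: Cholder_eq (CholderD oU (IH _ _ wf (Dg i)) (IH _ _ wg (Df i))) => // x Ux.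
by rewrite deriveM//; apply: diff_derivable; [exact: df|exact: dg].
Qed.

End ScalarTarget.

Lemma Cholder_weaken m theta theta' k (U : set 'rV[R]_n)
    (f : 'rV[R]_n -> 'rV[R]_m) : theta <= 1 ->
  open U -> Cholder theta' k.+1 U f -> Cholder theta k U f.
Proof.
move=> t1 oU /(Cholder_row _ _ _ oU) Cf; apply/Cholder_row => // j.
exact: Cholder_weaken_scalar (Cf j).
Qed.

(** Goes through order k + 1 with exponent 0, where the Hoelder condition
follows from continuity. *)
Lemma smooth_on_Cholder m theta k (U : set 'rV[R]_n)
    (f : 'rV[R]_n -> 'rV[R]_m) : theta <= 1 ->
  open U -> smooth_on U f -> Cholder theta k U f.
Proof.
by move=> t1 oU sf; apply: (@Cholder_weaken m theta 0) => //; exact: Ck_Cholder0.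
Qed.

End HolderClasses.

(** * Composition *)

Lemma derive_comp_partial (R : realType) (n p : nat)
    (g : 'rV[R]_n -> 'rV[R]_p) (f : 'rV[R]_p -> R) (v x : 'rV[R]_n) :
  differentiable g x -> differentiable f (g x) ->
  'D_v (f \o g) x =
  \sum_(j < p) 'D_(delta_mx 0 j) f (g x) * 'D_v (fun y => g y 0 j) x.
Proof.
move=> dg df; rewrite deriveE; last exact: differentiable_comp.
rewrite diff_comp//= diff_partial//; apply: eq_bigr => j _.
rewrite -deriveE// mulrC derive_mx ?mxE//; exact: diff_derivable.
Qed.

(** The Lipschitz hypothesis on [g] is separate because it must survive down to
k = 0, where it is no longer a consequence of the regularity of [g]. *)
Lemma Cholder_comp_scalar (R : realType) (n p : nat) (theta : R) k
    (U : set 'rV[R]_n) (W : set 'rV[R]_p)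
    (g : 'rV[R]_n -> 'rV[R]_p) (f : 'rV[R]_p -> R) :
  0 <= theta <= 1 -> open U -> g @` U `<=` W ->
  locally_holder_on 1 U g ->
  Cholder theta k U g -> Cholder theta k W f -> Cholder theta k U (f \o g).
Proof.
move=> /andP[t0 t1] oU gUW lipg; elim: k f => [|k IH] f Cg Cf.
  split=> [x Ux|].
    apply: continuous_comp; first exact: Cg.1.
    exact: (Cf.1 _ (gUW _ (imageP _ Ux))).
  exact: (holder_comp t0 gUW Cg.1 lipg Cf.2).
have [dg Dg] := Cg; have [df Df] := Cf.
have dfg x : U x -> differentiable f (g x) by move=> Ux; exact/df/gUW/imageP.
split=> [x Ux|i].
  by apply: differentiable_comp; [exact: dg|exact: dfg].
have Cgj := (Cholder_row _ _ _ oU).2 Cg.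
have wg := Cholder_weaken t1 oU Cg.
pose h j := ('D_(delta_mx 0 j) f \o g) * 'D_(delta_mx 0 i) (fun y => g y 0 j).
(* the chain rule holds only on [U], whence the transfer of regularity *)
apply: (@Cholder_eq _ _ _ _ _ _ (\sum_(j < p) h j)) => // [x Ux|].
  by rewrite fct_sumE derive_comp_partial//; [exact: dg|exact: dfg].
apply: Cholder_sum => // j; apply: CholderM => //; first exact: (IH _ wg (Df j)).
by have [_ ] := Cgj j; exact.
Qed.

Lemma Cholder_comp (R : realType) (n p q : nat) (theta : R) k
    (U : set 'rV[R]_n) (W : set 'rV[R]_p)
    (g : 'rV[R]_n -> 'rV[R]_p) (f : 'rV[R]_p -> 'rV[R]_q) :
  0 <= theta <= 1 -> open U -> open W -> g @` U `<=` W ->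
  Cholder theta k.+1 U g -> Cholder theta k.+1 W f ->
  Cholder theta k.+1 U (f \o g).
Proof.
move=> t01 oU oW gUW Cg /(Cholder_row _ _ _ oW) Cf; apply/Cholder_row => // j.
apply: (Cholder_comp_scalar t01 oU gUW _ Cg (Cf j)).
exact: Cholder_lipschitz Cg.
Qed.

(** * Subgroups and morphisms *)

Section GeneratedSubgroups.
Variables X Y : groupType.
Implicit Types (A G : set X) (psi : X -> Y).

Lemma subgroupP (Z : groupType) (G : set Z) : subgroup G <->
  G 1%g /\ forall x y, G x -> G y -> G (x * y^-1)%g.
Proof.
split=> [[/set_mem G1 Gdiv]|[G1 Gdiv]].
  by split=> // x y Gx Gy; apply: set_mem; apply: Gdiv; exact: mem_set.
split; first exact: mem_set.
by move=> x y /set_mem Gx /set_mem Gy; apply: mem_set; exact: Gdiv.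
Qed.

Lemma sub_generated (Z : groupType) (A : set Z) : A `<=` generated A.
Proof. by move=> x Ax G [_]; exact. Qed.

Lemma generated_min (Z : groupType) (A G : set Z) :
  subgroup G -> A `<=` G -> generated A `<=` G.
Proof. by move=> sG AG x; apply; split. Qed.

Lemma subgroup_generated (Z : groupType) (A : set Z) : subgroup (generated A).
Proof.
apply/subgroupP; split=> [G [/subgroupP[]]//|x y Ax Ay G GA].
by have [/subgroupP[_ Gdiv] _] := GA; apply: Gdiv; [exact: Ax|exact: Ay].
Qed.

Lemma morphism_div (G : set X) psi : subgroup G ->
  {in G &, {morph psi : x y / (x * y)%g}} ->
  psi 1%g = 1%g /\
  forall x y, G x -> G y -> psi (x * y^-1)%g = (psi x * (psi y)^-1)%g.
Proof.
move=> /subgroupP[G1 Gdiv] mpsi.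
split=> [|x y Gx Gy].
  have psi11 := mpsi 1%g 1%g (mem_set G1) (mem_set G1).
  by apply: (@mulgI _ (psi 1%g)); rewrite mulg1 -psi11 mulg1.
have psixy := mpsi (x * y^-1)%g y (mem_set (Gdiv _ _ Gx Gy)) (mem_set Gy).
by apply: (@mulIg _ (psi y)); rewrite -psixy !mulgVK.
Qed.

(** The image of the generated subgroup is a subgroup containing [psi @` A]; and
the elements mapped into the subgroup generated by [psi @` A] form a subgroup
containing [A]. *)
Lemma image_generated A psi :
  {in generated A &, {morph psi : x y / (x * y)%g}} ->
  psi @` generated A = generated (psi @` A).
Proof.
move=> mpsi; have sA := subgroup_generated A.
have [psi1 psiV] := morphism_div sA mpsi.
have [A1 AV] := (subgroupP _).1 sA.
apply/seteqP; split; last first.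
  apply: generated_min; last first.
    by move=> _ [x Ax <-]; exists x => //; exact: sub_generated.
  apply/subgroupP; split; first by exists 1%g.
  move=> _ _ [x Ax <-] [y Ay <-]; exists (x * y^-1)%g; last exact: psiV.
  exact: AV.
have [B1 BV] := (subgroupP _).1 (subgroup_generated (psi @` A)).
have : generated A `<=` generated A `&` psi @^-1` generated (psi @` A).
  apply: generated_min; last first.
    move=> x Ax; split; first exact: sub_generated.
    by apply: sub_generated; exists x.
  apply/subgroupP; split; first by split; rewrite /= ?psi1.
  move=> x y [Ax Bx] [Ay By]; split; first exact: AV.
  by rewrite /= psiV//; exact: BV.
by move=> AB _ [x /AB[_ Bx] <-].
Qed.

End GeneratedSubgroups.

(** * The group of C^beta diffeomorphisms *)

Section DiffGroup.
Variables (R : realType) (n : nat) (M : smoothManifold R n).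
Implicit Types (c d e : chart R n M) (f g : homeo M).

(** This set is the preimage of [A] under the inverse of the chart, which is
continuous on the open image of the chart. *)
Lemma chart_image_open c (A : set M) : open A -> open (c @` (chart_dom c `&` A)).
Proof.
move=> oA.
have -> : c @` (chart_dom c `&` A) =
    c @` chart_dom c `&` chart_inv c @^-1` A.
  apply/seteqP; split=> [_ [p [cp Ap] <-]|_ [[p cp <-] /=]].
    by split; [exists p|rewrite /= chartK//; exact: mem_set].
  by rewrite chartK ?inE// => Ap; exists p.
have oc := @chart_codom_open _ _ _ c.
rewrite openE => x [cx Ax]; apply: filterI; first exact: open_nbhs_nbhs.
have := @chart_inv_continuous _ _ _ c.
rewrite continuous_open_subspace// => /(_ x (mem_set cx)); apply.
exact: open_nbhs_nbhs.
Qed.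

Lemma transition_open c d f :
  open (c @` (chart_dom c `&` f @^-1` chart_dom d)).
Proof.
apply: chart_image_open; apply: open_comp; last exact: chart_dom_open.
by move=> x _; exact: homeo_continuous.
Qed.

Section Exponent.
Variable beta : R.
Hypothesis beta1 : 1 <= beta.

Let truncSE : exists k, Num.truncn beta = k.+1.
Proof.
by exists (Num.truncn beta).-1; rewrite prednK// truncn_gt0.
Qed.

Let frac01 : 0 <= beta - (Num.truncn beta)%:R <= 1.
Proof.
have /truncn_itv/andP[b0 b1] : 0 <= beta by exact: le_trans beta1.
by rewrite subr_ge0 b0/= lerBlDl ltW// natr1.
Qed.

(** Near a point [p], read the composite as the product of [g] from [c] to an
intermediate chart [e] around [g p], and of [f] from [e] to [d]. *)
Lemma regular_map_comp f g :
  regular_map (Calpha_on beta) f -> regular_map (Calpha_on beta) g ->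
  regular_map (Calpha_on beta) ((f * g)%g : homeo M).
Proof.
move=> rf rg c d ac ad; apply/Calpha_onP; have [k bk] := truncSE.
apply: Cholder_local => _ [p [cp dp] <-].
have [e ae ep] : (\bigcup_(e in @atlas R n M) chart_dom e) (g p).
  by rewrite atlas_cover.
(* the points where the expression of the composite factors through [e] *)
pose A := g @^-1` chart_dom e `&` (f * g)%g @^-1` chart_dom d.
have oA : open A.
  by apply: openI; apply: open_comp => [x _|]; try exact: homeo_continuous;
    exact: chart_dom_open.
have oW : open (c @` (chart_dom c `&` A)) by exact: chart_image_open.
exists (c @` (chart_dom c `&` A)); first by exists p.
apply: (@Cholder_eq _ _ _ _ _ _
    ((d \o f \o chart_inv e) \o (e \o g \o chart_inv c))) => // [|].
  move=> _ [q [cq [eq dq]] <-] /=.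
  by rewrite (chartK (mem_set cq)) (chartK (mem_set eq)).
have Cf := (Calpha_onP _ _ _).1 (rf e d ae ad).
have Cg := (Calpha_onP _ _ _).1 (rg c e ac ae).
move: frac01 Cf Cg; rewrite bk => t01 Cf Cg.
apply: (Cholder_comp t01 oW (@transition_open e d f) _ _ Cf).
  move=> _ [_ [q [cq [eq dq]] <-] <-] /=; exists (g q); first by split.
  by rewrite (chartK (mem_set cq)).
by apply: Cholder_sub Cg => _ [q [cq [eq dq]] <-]; exists q.
Qed.

Lemma regular_smooth f :
  regular_map (@smooth_on R n _) f -> regular_map (Calpha_on beta) f.
Proof.
move=> sf c d ac ad; apply/Calpha_onP.
have /andP[_ t1] := frac01.
apply: smooth_on_Cholder => //; last exact: sf.
exact: transition_open.
Qed.

Lemma Diff_infty_sub : Diff_infty M `<=` Diff M beta.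
Proof. by move=> f [sf sfV]; split; exact: regular_smooth. Qed.

(** In charts the identity is a transition map of the atlas. *)
Lemma Diff_infty1 : Diff_infty M (1%g : homeo M).
Proof.
have s1 : regular_map (@smooth_on R n _) ((1%g : homeo M)).
  by move=> c d ac ad; exact: atlas_compatible.
by split=> //; rewrite invg1.
Qed.

Lemma Diff_inv f : Diff M beta f -> Diff M beta (f^-1)%g.
Proof. by move=> [rf rfV]; split=> //; rewrite invgK. Qed.

Lemma Diff_mul f g : Diff M beta f -> Diff M beta g -> Diff M beta (f * g)%g.
Proof.
move=> [rf rfV] [rg rgV]; split; first exact: regular_map_comp.
by rewrite invgM; exact: regular_map_comp.
Qed.

Lemma subgroup_Diff : subgroup (Diff M beta).
Proof.
apply/subgroupP; split; first exact/Diff_infty_sub/Diff_infty1.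
by move=> f g Df Dg; apply: Diff_mul => //; exact: Diff_inv.
Qed.

End Exponent.

End DiffGroup.

Theorem proposition1p5 (R : realType) (n : nat) (M : smoothManifold R n)
    (alpha : R) (Gamma : set (homeo M)) (U : set M) :
  1 <= alpha ->
  subgroup Gamma -> Gamma `<=` Diff_infty M ->
  rigid alpha Gamma ->
  open U -> U !=set0 ->
  recognizes Gamma [set f | homeo_support f `<=` U] ->
  forall (f : homeo M) (beta : R), homeo_support f `<=` U -> alpha <= beta ->
    (exists phi : homeo M -> homeo M,
       faithful_morphism (generated (Gamma `|` [set f])) (Diff M beta) phi) <->
    Diff M beta f.
Proof.
move=> a1 sG Gsmooth rG oU U0 recG f beta fU ab.
have b1 : 1 <= beta by exact: le_trans ab.
have sD : subgroup (Diff M beta) by exact: subgroup_Diff.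
split=> [[phi [phiD phiM phiI]]|Df]; last first.
  exists id; split=> //; apply: generated_min => // x [/Gsmooth|->//].
  exact: Diff_infty_sub.
set G := generated _ in phiD phiM phiI.
have GG : Gamma `<=` G by move=> x Gx; apply: sub_generated; left.
have Gf : G f by apply: sub_generated; right.
have inG x : x \in Gamma -> x \in G by move=> /set_mem/GG/mem_set.
have [|g Dg gP] := rG beta ab phi.
  split; first by move=> x /GG; exact: phiD.
    by move=> x y /inG xG /inG yG; exact: phiM.
  by move=> x y /inG xG /inG yG; exact: phiI.
(* undo on the larger group the conjugation that [phi] performs on [Gamma] *)
pose psi x := (g^-1 * phi x * g)%g; pose h := psi f.
have Dh : Diff M beta h.
  by apply: Diff_mul => //; apply: Diff_mul => //; [exact: Diff_inv|exact: phiD].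
have psiG : {in Gamma, psi =1 id}.
  by move=> x /gP phix; rewrite /psi phix !mulgA mulVg mul1g mulgVK.
have psiM : {in G &, {morph psi : x y / (x * y)%g}}.
  by move=> x y xG yG; rewrite /psi phiM// !mulgA mulgK.
have psiI : set_inj G psi.
  by move=> x y xG yG /mulIg/mulgI; exact: phiI.
suff <- : h = f by [].
apply: recG => //; exists psi; split=> //; split=> //.
have imG : psi @` G = generated (Gamma `|` [set h]).
  rewrite image_generated// image_setU image_set1; congr (generated (_ `|` _)).
  apply/seteqP; split=> [_ [x Gx <-]|x Gx]; first by rewrite psiG// inE.
  by exists x => //; rewrite psiG// inE.
by rewrite -imG; split=> // x Gx; exists x.
Qed.
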